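(* Let $M$ be a hypergraph model and let $E$ be a hyperedge in $M$. (1) If $M\in\mathcal{H}_n^{su}$ (i.e. $M$ is simple and $n$-uniform), then for all $\varphi\in\mathcal{L}_B$: $M,E\models_{H}\varphi$ if and only if $\mathfrak{K}(M),E\models_{K}\varphi$. (2) If $M\in\mathcal{H}_n^{sut}$ (i.e. $M$ is simple, $n$-uniform and tail-complete), then for all $\varphi\in\mathcal{L}_B^K$: $M,E\models_{H}\varphi$ if and only if $\mathfrak{K}(M),E\models_{K}\varphi$. Here $\mathfrak{K}(M)$ is the Kripke model associated with $M$.
   Context: Fix a set $\mathcal{A}$ of $n\geq 1$ agents (finite, $|\mathcal{A}|=n$). Each $a\in\mathcal{A}$ has a countable set $\mathsf{Var}_a$ of propositional letters; these sets are pairwise disjoint, and $\mathsf{Var}:=\bigcup_{a\in\mathcal{A}}\mathsf{Var}_a$. The language $\mathcal{L}_B^K$ is generated by $\varphi::=p\mid\neg\varphi\mid\varphi\wedge\varphi\mid B_a\varphi\mid K_a\varphi$ ($p\in\mathsf{Var}$, $a\in\mathcal{A}$); $\mathcal{L}_B$ is its fragment without the operators $K_a$. Kripke models. A doxastic Kripke model is a triple $N=(W,R,V)$ with $W\neq\emptyset$ a set, $R$ assigning to each $a\in\mathcal{A}$ a relation $R_a\subseteq W\times W$, and $V:W\to\mathcal{P}(\mathsf{Var})$. For a relation $S$, $S^{\equiv}$ is the smallest equivalence relation containing $S$. Satisfaction: $N,w\models_Kp$ iff $p\in V(w)$; $\neg,\wedge$ as usual; $N,w\models_KB_a\varphi$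 iff $N,u\models_K\varphi$ for all $u$ with $wR_au$; $N,w\models_KK_a\varphi$ iff $N,u\models_K\varphi$ for all $u$ with $wR_a^{\equiv}u$. Hypergraph models. A directed hyperedge over a set $\mathscr{V}$ is a pair $E=(X,Y)$ of finite disjoint (possibly empty) subsets of $\mathscr{V}$; $T(E):=X$ (tail), $H(E):=Y$ (head), $U(E):=T(E)\cup H(E)$. A directed hypergraph is a pair $G=(\mathscr{V}(G),\mathscr{E}(G))$ with $\mathscr{V}(G)$ a non-empty set and $\mathscr{E}(G)$ a set of directed hyperedges over $\mathscr{V}(G)$. $G$ is simple if for all $E_1,E_2\in\mathscr{E}(G)$, $E_1\neq E_2$ implies $U(E_1)\not\subseteq U(E_2)$; $k$-uniform if $|U(E)|=k$ for all $E\in\mathscr{E}(G)$; tail-complete if $\mathscr{V}(G)=\bigcup_{E\in\mathscr{E}(G)}T(E)$. A coloring of $G$ is a map $\chi:\mathscr{V}(G)\to\mathcal{A}$ such that for every $E\in\mathscr{E}(G)$ and all distinct $u,v\in U(E)$, $\chi(u)\neq\chi(v)$. A hypergraph model is a triple $M=(G,\chi,\ell)$ with $G$ a directed hypergraph, $\chi$ a coloring of $G$, and $\ell:\mathscr{V}(G)\to\mathcal{P}(\mathsf{Var})$ such that $\chi(u)=a$ implies $\ell(u)\subseteq\mathsf{Var}_a$. It is simple ($n$-uniform, tail-complete) if $G$ is. For $E\in\mathscr{E}(G)$ put $\ell(E):=\bigcup_{u\in U(E)}\ell(u)$. For $E_1,E_2\in\mathscr{E}(G)$: $E_1\vartriangleright_aE_2$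 iff some $u\in U(E_1)\cap T(E_2)$ has $\chi(u)=a$; $E_1\approx_aE_2$ iff some $u\in U(E_1)\cap U(E_2)$ has $\chi(u)=a$. Satisfaction: $M,E\models_Hp$ iff $p\in\ell(E)$; $\neg,\wedge$ as usual; $M,E\models_HB_a\varphi$ iff $M,E'\models_H\varphi$ for all $E'\in\mathscr{E}(G)$ with $E\vartriangleright_aE'$; $M,E\models_HK_a\varphi$ iff $M,E'\models_H\varphi$ for all $E'\in\mathscr{E}(G)$ with $E\approx_aE'$. The model $\mathfrak{K}(M)$. For a hypergraph model $M=(G,\chi,\ell)$, $\mathfrak{K}(M)=(W,R,V)$ where $W:=\mathscr{E}(G)$; $(E_1,E_2)\in R_a$ iff $E_1\vartriangleright_aE_2$; and $V(E):=\ell(E)$ for all $E\in W$. *)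

(* Defs.v *)
From Stdlib Require Import Relation_Definitions.
From mathcomp Require Import all_boot.
From mathcomp Require Import boolp classical_sets functions cardinality.

Set Implicit Arguments.
Unset Strict Implicit.
Unset Printing Implicit Defensive.

Local Open Scope classical_set_scope.
Local Open Scope card_scope.

Section Language.
Variables (A : finType) (Var : A -> countType).

(* The disjoint union of the Var a: tagging a letter by its agent makes the
   sets Var_of a pairwise disjoint. *)
Definition letter := {a : A & Var a}.

Definition Var_of (a : A) : set letter := [set p | tag p = a].

Inductive formula :=
  | Atom of letter
  | Neg of formula
  | And of formula & formula
  | Bel of A & formula
  | Know of A & formula.

(* Every formula is in the language with B_a and K_a; LB cuts out the fragment
   without K_a. *)
Fixpoint LB (phi : formula) : Prop :=
  match phi with
  | Atom _ => True
  | Neg f => LB f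
  | And f g => LB f /\ LB g
  | Bel _ f => LB f
  | Know _ _ => False
  end.

End Language.

Section Kripke.
Variables (A : finType) (Var : A -> countType).

Record kripke_model := KripkeModel {
  world : Type;
  world_nonempty : inhabited world;
  acc : A -> set (world * world);
  val_at : world -> set (letter Var)
}.

Arguments acc : clear implicits.

Definition equiv_closure (W : Type) (S : set (W * W)) : set (W * W) :=
  smallest [set Q | equivalence W (fun x y => Q (x, y))] S.

Fixpoint satK (N : kripke_model) (w : world N) (phi : formula Var) : Prop :=
  match phi with
  | Atom p => val_at w p
  | Neg f => ~ satK w f
  | And f g => satK w f /\ satK w g
  | Bel a f => forall u : world N, acc N a (w, u) -> satK u f
  | Know a f =>
      forall u : world N, equiv_closure (acc N a) (w, u) -> satK u f
  end.

End Kripke.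

Definition tail (V : Type) (E : set V * set V) : set V := E.1.
Definition head (V : Type) (E : set V * set V) : set V := E.2.
Definition under (V : Type) (E : set V * set V) : set V := tail E `|` head E.

Definition directed_hyperedge (V : Type) (E : set V * set V) : Prop :=
  [/\ finite_set (tail E), finite_set (head E) & tail E `&` head E = set0].

Record hypergraph := Hypergraph {
  vertex : Type;
  vertex_nonempty : inhabited vertex;
  edges : set (set vertex * set vertex);
  edgesP : forall E, edges E -> directed_hyperedge E
}.

Arguments edges : clear implicits.

Definition simple (G : hypergraph) : Prop :=
  forall E1 E2, edges G E1 -> edges G E2 -> E1 <> E2 ->
    ~ (under E1 `<=` under E2).

Definition uniform (k : nat) (G : hypergraph) : Prop :=
  forall E, edges G E -> under E #= `I_k.

Definition tail_complete (G : hypergraph) : Prop :=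
  [set: vertex G] = \bigcup_(E in edges G) tail E.

Definition coloring (A : Type) (G : hypergraph) (chi : vertex G -> A) : Prop :=
  forall E, edges G E -> forall u v, under E u -> under E v -> u <> v ->
    chi u <> chi v.

Section HypergraphModel.
Variables (A : finType) (Var : A -> countType).

Record hypergraph_model := HypergraphModel {
  hgraph :> hypergraph;
  color : vertex hgraph -> A;
  colorP : coloring color;
  label : vertex hgraph -> set (letter Var);
  labelP : forall u a, color u = a -> label u `<=` Var_of a
}.

Definition edge (M : hypergraph_model) : Type := set_type (edges M).

Section Relations.
Variable M : hypergraph_model.

Definition edge_label (E : edge M) : set (letter Var) :=
  \bigcup_(u in under (val E)) @label M u.

Definition brel (a : A) (E1 E2 : edge M) : Prop :=
  exists2 u, (under (val E1) `&` tail (val E2)) u & color u = a.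

Definition krel (a : A) (E1 E2 : edge M) : Prop :=
  exists2 u, (under (val E1) `&` under (val E2)) u & color u = a.

Fixpoint satH (E : edge M) (phi : formula Var) : Prop :=
  match phi with
  | Atom p => edge_label E p
  | Neg f => ~ satH E f
  | And f g => satH E f /\ satH E g
  | Bel a f => forall E' : edge M, brel a E E' -> satH E' f
  | Know a f => forall E' : edge M, krel a E E' -> satH E' f
  end.

End Relations.

Definition H_su (n : nat) (M : hypergraph_model) : Prop :=
  simple M /\ uniform n M.

Definition H_sut (n : nat) (M : hypergraph_model) : Prop :=
  [/\ simple M, uniform n M & tail_complete M].

(* A hypergraph may have no hyperedge, whereas a Kripke model has a world;
   hence the argument edge_nonempty. *)
Definition kripke_of (M : hypergraph_model) (edge_nonempty : inhabited (edge M))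
    : kripke_model Var :=
  {| world := edge M;
     world_nonempty := edge_nonempty;
     acc := fun a => [set E12 | brel a E12.1 E12.2];
     val_at := @edge_label M |}.

End HypergraphModel.

(* Main.v *)
(* When every edge has n vertices and colors are distinct along an edge, each
   edge has exactly one vertex of each color, so "sharing an a-colored vertex"
   is an equivalence relation on edges; it contains brel a, hence its
   equivalence closure.  Conversely, if E1 and E2 share u, tail-completeness
   puts u in the tail of some edge E3, and brel a E1 E3, brel a E2 E3 show that
   E1 and E2 are related in the closure. *)
Require Import Defs.
From Stdlib Require Import Relation_Definitions.
From mathcomp Require Import all_boot.
From mathcomp Require Import boolp classical_sets functions cardinality.

Set Implicit Arguments.
Unset Strict Implicit.
Unset Printing Implicit Defensive.

Local Open Scope classical_set_scope.
Local Open Scope card_scope.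

(** Pigeonhole: an injective map between finite sets of equal cardinality is onto. Precomposing
    [chi] with a section [g] of an enumeration of [U] turns it into an injection from ['I_#|A|] to
    [A]. *)
Lemma full_coloring_surj (A : finType) (V : Type) (U : set V) (chi : V -> A) :
    U #= `I_#|A| ->
    (forall u v, U u -> U v -> u <> v -> chi u <> chi v) ->
  forall a, exists2 u, U u & chi u = a.
Proof.
move=> /card_set_bijP[f [_ _ fsurj]] chiU a.
have /choice[g gP] (i : 'I_#|A|) : exists v, U v /\ f v = i.
  by have [v Uv fv] := fsurj i (ltn_ord i); exists v.
have g_inj : injective (chi \o g).
  move=> i j eq_ij; apply: val_inj => /=.
  have [[Ui <-] [Uj <-]] := (gP i, gP j).
  by congr f; apply: contrapT => /(chiU _ _ Ui Uj).
(* [h] inverts [chi \o g], so [g (h a)] is the vertex of color [a]. *)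
have [|h _ hK] := inj_card_bij g_inj; first by rewrite card_ord.
by exists (g (h a)); [exact: (gP _).1 | exact: hK].
Qed.

Section EquivClosure.
Variables (W : Type) (S : set (W * W)).

Lemma sub_equiv_closure : S `<=` equiv_closure S.
Proof. exact: sub_gen_smallest. Qed.

Lemma equiv_closure_min (Q : set (W * W)) :
  equivalence W (fun x y => Q (x, y)) -> S `<=` Q -> equiv_closure S `<=` Q.
Proof. exact: smallest_sub. Qed.

(** The closure is the intersection of all equivalences [Q] containing [S], and each such [Q] is
    symmetric. *)
Lemma equiv_closure_sym x y : equiv_closure S (x, y) -> equiv_closure S (y, x).
Proof. by move=> xy Q QP; case: QP.1 => _ _; apply; exact: xy. Qed.

Lemma equiv_closure_trans y x z :
  equiv_closure S (x, y) -> equiv_closure S (y, z) -> equiv_closure S (x, z).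
Proof.
by move=> xy yz Q QP; case: QP.1 => _ Qtrans _; exact: Qtrans (xy Q QP) (yz Q QP).
Qed.

End EquivClosure.

Section HypergraphRelations.
Variables (A : finType) (Var : A -> countType) (M : hypergraph_model Var).
Implicit Types (a : A) (E : edge M).

Lemma edgeP E : edges M (val E).
Proof. exact: set_valP. Qed.

Lemma color_inj E u v :
  under (val E) u -> under (val E) v -> color u = color v -> u = v.
Proof.
by move=> Eu Ev uv; apply: contrapT => /(colorP (edgeP E) Eu Ev).
Qed.

Lemma brel_krel a E1 E2 : brel a E1 E2 -> krel a E1 E2.
Proof. by case=> u [E1u E2u] ua; exists u => //; split=> //; left. Qed.

Lemma krel_equiv a : uniform #|A| M -> equivalence (edge M) (krel a).
Proof.
move=> unifM; split=> [E|E1 E2 E3|E1 E2].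
- have [u Eu ua] :=
    full_coloring_surj (unifM _ (edgeP E)) (colorP (edgeP E)) a.
  by exists u.
- move=> [u [E1u E2u] ua] [v [E2v E3v] va]; exists u => //; split=> //.
  (* Both [u] and [v] are vertices of color [a] in the middle edge [E2], so they coincide. *)
  by rewrite (color_inj E2u E2v) // ua va.
- by move=> [u [E1u E2u] ua]; exists u.
Qed.

Lemma krel_equiv_closure a E1 E2 : uniform #|A| M -> tail_complete M ->
  krel a E1 E2 <-> equiv_closure [set E12 | brel a E12.1 E12.2] (E1, E2).
Proof.
move=> unifM tailM; split=> [[u [E1u E2u] ua]|].
  have [E3 E3M E3u] : (\bigcup_(E in edges M) tail E) u by rewrite -tailM.
  pose F : edge M := SigSub (mem_set E3M).
  apply: (@equiv_closure_trans _ _ F).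
    by apply: sub_equiv_closure; exists u.
  by apply: equiv_closure_sym; apply: sub_equiv_closure; exists u.
apply: (@equiv_closure_min _ _ [set E12 | krel a E12.1 E12.2]).
  exact: krel_equiv.
by move=> [F1 F2]; exact: brel_krel.
Qed.

(** The disjunction lets one induction serve both claims: it passes to subformulas, and at [Know]
    its left side is false, which leaves tail-completeness. *)
Lemma satH_satK (ne : inhabited (edge M)) (phi : formula Var) E :
    uniform #|A| M -> LB phi \/ tail_complete M ->
  satH E phi <-> satK (N := kripke_of ne) E phi.
Proof.
move=> unifM; elim: phi E => [p|f IHf|f IHf g IHg|a f IHf|a f IHf] E //= hM.
- by rewrite (propext (IHf E hM)).
- have [hf hg] : (LB f \/ tail_complete M) /\ (LB g \/ tail_complete M).
    by case: hM => [[? ?]|?]; split; by [left | right].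
  by rewrite (propext (IHf E hf)) (propext (IHg E hg)).
(* Accessibility in [kripke_of] is [brel a] by definition, so both clauses range over the same
   edges. *)
- by split=> sat F EF; apply/(IHf F hM)/sat.
- case: hM => // tailM.
  have IH F := IHf F (or_intror tailM).
  by split=> sat F EF; apply/IH/sat/krel_equiv_closure.
Qed.

End HypergraphRelations.

Theorem proposition6 (n : nat) (A : finType) (Var : A -> countType)
    (n_ge1 : (1 <= n)%N) (cardA : #|A| = n)
    (M : hypergraph_model Var) (E : edge M) :
  (H_su n M -> forall phi : formula Var, LB phi ->
     (satH E phi <-> satK (N := kripke_of (inhabits E)) E phi)) /\
  (H_sut n M -> forall phi : formula Var,
     (satH E phi <-> satK (N := kripke_of (inhabits E)) E phi)).
Proof.
split=> [[_ unifM] phi LBphi|[_ unifM tailM] phi].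
  by apply: satH_satK; [rewrite cardA | left].
by apply: satH_satK; [rewrite cardA | right].
Qed.
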